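(* Let $\Gamma$ be a closed oriented surface, $M=\Gamma\times[0,1]_t\times[0,1]_s$ with orientation $\mathrm{or}(M)=\mathrm dt\wedge\mathrm ds\wedge\mathrm{or}(\Gamma)$, and for $\varepsilon,\eta\in\{0,1\}$ put $$\Sigma_t^\varepsilon=\Gamma\times\{\varepsilon\}\times[0,1]_s,\quad \mathrm{or}(\Sigma_t^\varepsilon)=\mathrm ds\wedge\mathrm{or}(\Gamma),\qquad \Sigma_s^\varepsilon=\Gamma\times[0,1]_t\times\{\varepsilon\},\quad \mathrm{or}(\Sigma_s^\varepsilon)=\mathrm dt\wedge\mathrm{or}(\Gamma),$$ $$\Gamma_{\varepsilon\eta}=\Gamma\times\{t=\varepsilon,\ s=\eta\},\quad \mathrm{or}(\Gamma_{\varepsilon\eta})=\mathrm{or}(\Gamma).$$ For each $\Gamma_{\varepsilon\eta}$, the two coefficients of the twice-iterated BF primitive are opposite. With the product orientations above, the incidence products $[M:\Sigma][\Sigma:\Gamma_{\varepsilon\eta}]$ are $$\begin{array}{c|cc} & \Sigma=\Sigma_t^\varepsilon & \Sigma=\Sigma_s^\eta\\ \hline \Gamma_{00} & (-1)(-1)=+1 & (+1)(-1)=-1\\ \Gamma_{01} & (-1)(+1)=-1 & (-1)(-1)=+1\\ \Gamma_{10} & (+1)(-1)=-1 & (+1)(+1)=+1\\ \Gamma_{11} & (+1)(+1)=+1 & (-1)(+1)=-1\end{array}$$ Consequently the codimension-two contribution to the iterated defect of the bulk BF identity $$\iota_{\mathsf Q_M}\omega_M^{\mathrm{BF}}=\delta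 S_M^{\mathrm{BF}}+\rho_{M\Sigma_t^1}^*\alpha_{\Sigma_t^1}^{\mathrm{BF}}-\rho_{M\Sigma_t^0}^*\alpha_{\Sigma_t^0}^{\mathrm{BF}}-\rho_{M\Sigma_s^1}^*\alpha_{\Sigma_s^1}^{\mathrm{BF}}+\rho_{M\Sigma_s^0}^*\alpha_{\Sigma_s^0}^{\mathrm{BF}}$$ is zero at every corner, i.e. for all $\varepsilon,\eta$, $$\sum_{\Sigma\in\{\Sigma_t^\varepsilon,\Sigma_s^\eta\}}[M:\Sigma][\Sigma:\Gamma_{\varepsilon\eta}]\,(\rho_{\Sigma\Gamma_{\varepsilon\eta}}\circ\rho_{M\Sigma})^*\alpha_{\Gamma_{\varepsilon\eta}}^{\mathrm{BF}}=0 .$$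
   Context: Incidence numbers: for a codimension-one face $G$ of an oriented face $F$ (with a fixed orientation on each), $[F:G]\in\{\pm1\}$ compares the orientation of $G$ induced from $F$ by the outward-normal-first convention (contracting the orientation form of $F$ with the outward normal) with the fixed orientation of $G$. BF data: $\mathfrak g$ is a finite-dimensional Lie algebra with a nondegenerate invariant pairing $\langle\cdot,\cdot\rangle$, the AKSZ target is $T^*[3](\mathfrak g[1])$ with its canonical degree-three symplectic form, and the fields on an oriented face $F$, i.e. points of $\mathcal F_F=\mathrm{Map}(T[1]F,T^*[3](\mathfrak g[1]))$, are superfields $\mathcal A\in\Omega^\bullet(F,\mathfrak g)[1]$, $\mathcal B\in\Omega^\bullet(F,\mathfrak g)[2]$. $\rho_{FG}:\mathcal F_F\to\mathcal F_G$ is restriction of superfields. $\delta$ is the de Rham differential on field space, $\mathrm d_F$ the source de Rham differential on $F$ (anticommuting with $\delta$), and $\int_F$ denotes Berezin fiber integration over $T[1]F$, so $\delta\int_F=(-1)^{\dim F}\int_F\delta$. Set $$\alpha_F^{\mathrm{BF}}=\int_F\langle\mathcal B,\delta\mathcal A\rangle,\quad \omega_F^{\mathrm{BF}}=\int_F\langle\delta\mathcal B,\delta\mathcal A\rangle,\quad S_F^{\mathrm{BF}}=\int_F\langle\mathcal B,\mathrm d_F\mathcal A+\tfrac12[\mathcal A,\mathcal A]\rangle .$$ $\mathsf Q_F$ is the degree-one vector field on $\mathcal F_F$ that is the sum of the lift (by precomposition) of the source de Rham vector field on $T[1]F$ and the lift (by postcomposition) of the target Hamiltonian vector field $\mathsf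 Q_{\mathcal Y}$ determined by $\iota_{\mathsf Q_{\mathcal Y}}\langle\mathrm dB,\mathrm dA\rangle=\mathrm d\big(\tfrac12\langle B,[A,A]\rangle\big)$, where $A$ (degree 1), $B$ (degree 2) are the target coordinates. Identities on mapping spaces are understood for local functionals and local field-space forms, assuming (formally) that evaluation, restriction, contraction and fiber integration exist and satisfy graded Cartan calculus and Stokes' formula. *)

(* Defs.v *)
From HB Require Import structures.
From mathcomp Require Import all_boot all_order all_algebra.
From mathcomp Require Import all_classical reals topology normedtype derive.

Set Implicit Arguments.
Unset Strict Implicit.
Unset Printing Implicit Defensive.

Import Order.TTheory GRing.Theory Num.Theory.
Import numFieldNormedType.Exports.

Local Open Scope classical_set_scope.
Local Open Scope ring_scope.

Section Smooth.
Variables (R : realType) (V W : normedModType R).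

Fixpoint Ck (k : nat) (U : set V) (f : V -> W) : Prop :=
  match k with
  | 0 => {in U, continuous f}
  | k'.+1 => (forall x, U x -> differentiable f x) /\
             (forall v, Ck k' U (fun x => 'D_v f x))
  end.

(* [U] is meant to be open. *)
Definition smooth_on (U : set V) (f : V -> W) : Prop := forall k, Ck k U f.

End Smooth.

Record chart (R : realType) (T : topologicalType) := Chart {
  chart_dom : set T;
  chart_cod : set 'rV[R]_2;
  chart_fwd : T -> 'rV[R]_2;
  chart_bwd : 'rV[R]_2 -> T;
  chart_dom_open : open chart_dom;
  chart_cod_open : open chart_cod;
  chart_fwd_in : forall p, chart_dom p -> chart_cod (chart_fwd p);
  chart_bwd_in : forall x, chart_cod x -> chart_dom (chart_bwd x);
  chart_fwdK : forall p, chart_dom p -> chart_bwd (chart_fwd p) = p;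
  chart_bwdK : forall x, chart_cod x -> chart_fwd (chart_bwd x) = x;
  chart_fwd_cont : {in chart_dom, continuous chart_fwd};
  chart_bwd_cont : {in chart_cod, continuous chart_bwd}
}.

Definition transition (R : realType) (T : topologicalType) (c c' : chart R T) :
  'rV[R]_2 -> 'rV[R]_2 := chart_fwd c' \o chart_bwd c.

Definition transition_dom (R : realType) (T : topologicalType)
    (c c' : chart R T) : set 'rV[R]_2 :=
  chart_cod c `&` chart_bwd c @^-1` chart_dom c'.

(* Second countability follows from compactness.  The orientation is a nowhere
   vanishing smooth 2-form; in a chart [c] with coordinates (x1, x2) it reads
   [surf_or c] dx1 /\ dx2.  The library's Jacobian acts on row vectors from the
   right, which does not affect its determinant. *)
Record closed_oriented_surface (R : realType) := ClosedOrientedSurface {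
  surf :> topologicalType;
  surf_nonempty : [set: surf] !=set0;
  surf_hausdorff : hausdorff_space surf;
  surf_compact : compact [set: surf];
  surf_atlas : set (chart R surf);
  surf_cover : forall p : surf, exists2 c, surf_atlas c & chart_dom c p;
  surf_smooth : forall c c', surf_atlas c -> surf_atlas c' ->
    smooth_on (transition_dom c c') (transition c c');
  surf_or : chart R surf -> 'rV[R]_2 -> R;
  surf_or_smooth : forall c, surf_atlas c ->
    @smooth_on R 'rV[R]_2 R^o (chart_cod c) (surf_or c);
  surf_or_neq0 : forall c x, surf_atlas c -> chart_cod c x -> surf_or c x != 0;
  surf_or_change : forall c c' x, surf_atlas c -> surf_atlas c' ->
    transition_dom c c' x ->
    surf_or c x = surf_or c' (transition c c' x)
                  * \det (jacobian (transition c c') x)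
}.

(* The first component describes t and the second one s: [None] lets the
   coordinate run through [0,1], [Some e] freezes it at e (false is 0, true
   is 1). *)
Notation face := (option bool * option bool)%type.

Definition faceM : face := (None, None).
Definition Sigma_t (e : bool) : face := (Some e, None).
Definition Sigma_s (e : bool) : face := (None, Some e).
Definition corner (e h : bool) : face := (Some e, Some h).

Definition fdim (F : face) : nat := (2 + (F.1 == None) + (F.2 == None))%N.

Definition subface (F G : face) : bool :=
  ((F.1 == None) || (F.1 == G.1)) && ((F.2 == None) || (F.2 == G.2)).

Definition facet (F G : face) : bool :=
  subface F G && (fdim F == (fdim G).+1).

Section Orientations.
Variables (R : realType) (Gamma : closed_oriented_surface R).

Definition coord_in (o : option bool) (u : R) : Prop :=
  if o is Some e then u = e%:R else 0 <= u <= 1.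

Definition face_points (F : face) : set (Gamma * (R * R)) :=
  [set x | coord_in F.1 x.2.1 /\ coord_in F.2 x.2.2].

(* Tangent vectors of M, in the coordinates (t, s) and a chart of Gamma. *)
Definition tangent : Type := (R * R * 'rV[R]_2)%type.

Definition tangent_to (F : face) (v : tangent) : Prop :=
  (F.1 != None -> v.1.1 = 0) /\ (F.2 != None -> v.1.2 = 0).

(* An exterior form at a point, as a function of its list of arguments; a k-form
   is only meant to be evaluated on lists of length k. *)
Definition ext_form : Type := seq tangent -> R.

Definition dt (v : tangent) : R := v.1.1.
Definition ds (v : tangent) : R := v.1.2.

(* theta /\ b, expanded along the slot that theta takes. *)
Definition wedge1 (theta : tangent -> R) (b : ext_form) : ext_form :=
  fun vs => \sum_(i < size vs) (-1) ^+ i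
    * theta (nth (0, 0, 0) vs i) * b (take i vs ++ drop i.+1 vs).

Definition contract (v : tangent) (b : ext_form) : ext_form :=
  fun vs => b (v :: vs).

Definition or_Gamma (c : chart R Gamma) (p : Gamma) : ext_form :=
  fun vs => surf_or c (chart_fwd c p)
    * \det (\matrix_(i < 2, j < 2) (nth (0, 0, 0) vs i).2 ord0 j).

Definition or_face (F : face) (c : chart R Gamma) (p : Gamma) : ext_form :=
  match F with
  | (None, None) => wedge1 dt (wedge1 ds (or_Gamma c p))
  | (Some _, None) => wedge1 ds (or_Gamma c p)
  | (None, Some _) => wedge1 dt (or_Gamma c p)
  | (Some _, Some _) => or_Gamma c p
  end.

(* Outward unit normal of [F] along its facet [G]: the coordinate frozen in [G]
   but not in [F] points upwards at the end 1 and downwards at the end 0. *)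
Definition outward_coord (f g : option bool) : R :=
  match f, g with
  | None, Some true => 1
  | None, Some false => -1
  | _, _ => 0
  end.

Definition outward_normal (F G : face) : tangent :=
  (outward_coord F.1 G.1, outward_coord F.2 G.2, 0).

(* Along [G], the orientation induced from [F] is [e] times the one of [G], up
   to a positive factor. *)
Definition induces (F G : face) (e : int) : Prop :=
  forall x c, face_points G x -> surf_atlas c -> chart_dom c x.1 ->
  exists2 lambda : R, 0 < lambda &
    forall vs, size vs = fdim G -> (forall v, v \in vs -> tangent_to G v) ->
    contract (outward_normal F G) (or_face F c x.1) vs
      = (e%:~R * lambda) * or_face G c x.1 vs.

(* [F : G], for a facet G of F; the value 0 is a junk value. *)
Definition incidence (F G : face) : int :=
  if `[< induces F G 1 >] then 1
  else if `[< induces F G (-1) >] then -1 else 0.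

(* The coefficient [F : G] [G : H] of a codimension-two face H of F reached
   through the facet G. *)
Definition incidence2 (F G H : face) : int := incidence F G * incidence G H.

Definition incidence_cell (S H : face) (a b c : int) : Prop :=
  [/\ incidence faceM S = a, incidence S H = b & incidence2 faceM S H = c].

End Orientations.

(* In the bidegree (k, m), k is the degree as a differential form (on the
   target, or on field space) and m is the internal degree; Koszul signs are
   governed by the total degree k + m. *)
Record bigraded_algebra (R : realType) := BigradedAlgebra {
  bg_alg :> algType R;
  bideg : int -> int -> bg_alg -> Prop;
  bideg0 : forall k m, bideg k m 0;
  bidegD : forall k m a x y,
    bideg k m x -> bideg k m y -> bideg k m (a *: x + y);
  bideg1 : bideg 0 0 1;
  bidegM : forall k m k' m' x y,
    bideg k m x -> bideg k' m' y -> bideg (k + k') (m + m') (x * y);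
  bideg_neg : forall k m x, k < 0 -> bideg k m x -> x = 0;
  bideg_span : forall x, exists (s : seq (int * int)) (f : int * int -> bg_alg),
    (forall i, bideg i.1 i.2 (f i)) /\ x = \sum_(i <- s) f i;
  bideg_direct : forall (s : seq (int * int)) (f : int * int -> bg_alg),
    uniq s -> (forall i, bideg i.1 i.2 (f i)) -> \sum_(i <- s) f i = 0 ->
    forall i, i \in s -> f i = 0;
  bg_comm : forall k m k' m' x y, bideg k m x -> bideg k' m' y ->
    x * y = (-1) ^ ((k + m) * (k' + m')) *: (y * x)
}.

Section Calculus.
Variable R : realType.
Implicit Types D E : bigraded_algebra R.

Definition has_bidegree D E (k m : int) (f : D -> E) : Prop :=
  forall a b x, bideg a b x -> bideg (a + k) (b + m) (f x).

Definition graded_derivation D (k m : int) (f : D -> D) : Prop :=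
  has_bidegree k m f /\
  forall a b x y, bideg a b x ->
    f (x * y) = f x * y + (-1) ^ ((k + m) * (a + b)) *: (x * f y).

Definition differential D (k m : int) (f : D -> D) : Prop :=
  graded_derivation k m f /\ forall x, f (f x) = 0.

(* f g = (-1)^(p q) g f for operators f, g of total degrees p, q *)
Definition gcommute D (p q : int) (f g : D -> D) : Prop :=
  forall x, f (g x) = (-1) ^ (p * q) *: g (f x).

Definition algebra_map D E (f : D -> E) : Prop :=
  [/\ has_bidegree 0 0 f, f 1 = 1 & forall x y, f (x * y) = f x * f y].

(* The pairing need not be symmetric. *)
Record quadratic_lie_algebra := QuadraticLieAlgebra {
  lie :> vectType R;
  bracket : lie -> lie -> lie;
  bracketDl : forall a x y z,
    bracket (a *: x + y) z = a *: bracket x z + bracket y z;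
  bracketDr : forall a x y z,
    bracket x (a *: y + z) = a *: bracket x y + bracket x z;
  bracket_alt : forall x, bracket x x = 0;
  bracket_jacobi : forall x y z,
    bracket x (bracket y z) + bracket y (bracket z x)
      + bracket z (bracket x y) = 0;
  pairing : lie -> lie -> R;
  pairingDl : forall a x y z,
    pairing (a *: x + y) z = a * pairing x z + pairing y z;
  pairingDr : forall a x y z,
    pairing x (a *: y + z) = a * pairing x y + pairing x z;
  pairing_invariant : forall x y z,
    pairing (bracket x y) z + pairing y (bracket x z) = 0;
  pairing_nondegl : forall x, (forall y, pairing x y = 0) -> x = 0;
  pairing_nondegr : forall y, (forall x, pairing x y = 0) -> y = 0
}.

Variable g : quadratic_lie_algebra.

Definition lie_dim : nat := \dim {: g}.
Definition lie_basis (i : 'I_lie_dim) : g := (vbasis {: g})`_i.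

(* Elements of D (x) g, given by their components in [lie_basis]. *)
Definition lie_valued D : Type := 'I_lie_dim -> D.

Definition lpair D (x y : lie_valued D) : D :=
  \sum_i \sum_j pairing (lie_basis i) (lie_basis j) *: (x i * y j).

Definition lbracket D (x y : lie_valued D) : lie_valued D := fun k =>
  \sum_i \sum_j
    coord (vbasis {: g}) k (bracket (lie_basis i) (lie_basis j)) *: (x i * y j).

(* Graded Cartan calculus on the graded manifold with global coordinates A of
   degree 1 and B of degree 2, both g-valued; the fibre coordinates of
   T*[3](g[1]), valued in the dual of g, are turned into B by the pairing.
   A vector field X acts on functions by X f = iota_X (d f). *)
Record bf_target := BFTarget {
  tforms :> bigraded_algebra R;
  td : {linear tforms -> tforms};
  td_diff : differential 1 0 td;
  tvect : lmodType R;
  tvdeg : int -> tvect -> Prop;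
  tcontr : tvect -> {linear tforms -> tforms};
  tcontr_lin : forall a X Y x,
    tcontr (a *: X + Y) x = a *: tcontr X x + tcontr Y x;
  tcontr_der : forall q X, tvdeg q X -> graded_derivation (-1) q (tcontr X);
  coordA : lie_valued tforms;
  coordB : lie_valued tforms;
  coordA_deg : forall i, bideg 0 1 (coordA i);
  coordB_deg : forall i, bideg 0 2 (coordB i);
  (* polynomials in A, B, dA, dB exhaust the forms ... *)
  coord_gen : forall P : tforms -> Prop,
    P 1 -> (forall a x y, P x -> P y -> P (a *: x + y)) ->
    (forall x y, P x -> P y -> P (x * y)) ->
    (forall i, [/\ P (coordA i), P (coordB i),
                   P (td (coordA i)) & P (td (coordB i))]) ->
    forall x, P x;
  (* ... and a vector field is freely determined by its components. *)
  coord_free : forall q (a b : lie_valued tforms),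
    (forall i, bideg 0 (q + 1) (a i)) -> (forall i, bideg 0 (q + 2) (b i)) ->
    exists! X, tvdeg q X /\ forall i,
      tcontr X (td (coordA i)) = a i /\ tcontr X (td (coordB i)) = b i
}.

Definition target_symplectic (Y : bf_target) : Y :=
  lpair (fun i => td Y (coordB Y i)) (fun i => td Y (coordA Y i)).

Definition target_hamiltonian (Y : bf_target) : Y :=
  2^-1 *: lpair (coordB Y) (lbracket (coordA Y) (coordA Y)).

Definition is_target_Q (Y : bf_target) (QY : tvect Y) : Prop :=
  tvdeg 1 QY /\
  tcontr QY (target_symplectic Y) = td Y (target_hamiltonian Y).

(* [frm None F] are the forms on the field space F_F = Map(T[1]F, Y), and
   [frm (Some G) F] those on T[1]G x F_F along F_F: source forms on G are
   functions there, and their degree counts as internal degree.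
   [delta] and [dsrc] are the field-space and source de Rham differentials,
   [contr] the contraction with a vector field of F_F, [fint] the Berezin
   integration along T[1]G, [pull N F G] the pullback along rho_{FG} : F_F -> F_G
   and [rsrc G H] the restriction of source forms from G to H.  The last two carry
   no hypothesis when the second face is not a face of the first one. *)
Record field_calculus (Gamma : closed_oriented_surface R) (Y : bf_target) :=
  FieldCalculus {
  frm : option face -> face -> bigraded_algebra R;

  delta : forall N F, {linear frm N F -> frm N F};
  delta_diff : forall N F, differential 1 0 (delta N F);

  vect : face -> lmodType R;
  vdeg : forall F, int -> vect F -> Prop;
  contr : forall N F, vect F -> {linear frm N F -> frm N F};
  vdegD : forall F q a (X X' : vect F),
    vdeg q X -> vdeg q X' -> vdeg q (a *: X + X');
  contr_lin : forall N F a (X X' : vect F) x,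
    contr N (a *: X + X') x = a *: contr N X x + contr N X' x;
  contr_der : forall N F q (X : vect F), vdeg q X ->
    graded_derivation (-1) q (contr N X);

  dsrc : forall G F, {linear frm (Some G) F -> frm (Some G) F};
  dsrc_diff : forall G F, differential 0 1 (@dsrc G F);
  dsrc_delta : forall G F, gcommute 1 1 (@dsrc G F) (delta (Some G) F);
  dsrc_contr : forall G F q (X : vect F), vdeg q X ->
    gcommute 1 (q - 1) (@dsrc G F) (contr (Some G) X);

  fint : forall G F, {linear frm (Some G) F -> frm None F};
  fint_deg : forall G F, has_bidegree 0 (- (fdim G)%:Z) (@fint G F);
  fint_delta : forall G F x,
    delta None F (fint G F x) = (-1) ^+ fdim G *: fint G F (delta (Some G) F x);
  fint_contr : forall G F q (X : vect F) x, vdeg q X ->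
    contr None X (fint G F x)
      = (-1) ^ ((q - 1) * (fdim G)%:Z) *: fint G F (contr (Some G) X x);

  pull : forall N F G, {linear frm N G -> frm N F};
  pull_alg : forall N F G, subface F G -> algebra_map (pull N F G);
  pull_id : forall N F x, pull N F F x = x;
  pull_comp : forall N F G H x, subface F G -> subface G H ->
    pull N F G (pull N G H x) = pull N F H x;
  pull_delta : forall N F G x, subface F G ->
    pull N F G (delta N G x) = delta N F (pull N F G x);
  pull_dsrc : forall K F G x, subface F G ->
    pull (Some K) F G (dsrc K G x) = dsrc K F (pull (Some K) F G x);
  pull_fint : forall K F G x, subface F G ->
    pull None F G (fint K G x) = fint K F (pull (Some K) F G x);

  rsrc : forall G H F, {linear frm (Some G) F -> frm (Some H) F};
  rsrc_alg : forall G H F, subface G H -> algebra_map (rsrc G H F);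
  rsrc_id : forall G F x, rsrc G G F x = x;
  rsrc_comp : forall G H K F x, subface G H -> subface H K ->
    rsrc H K F (rsrc G H F x) = rsrc G K F x;
  rsrc_delta : forall G H F x, subface G H ->
    rsrc G H F (delta (Some G) F x) = delta (Some H) F (rsrc G H F x);
  rsrc_contr : forall G H F (X : vect F) x, subface G H ->
    rsrc G H F (contr (Some G) X x) = contr (Some H) X (rsrc G H F x);
  rsrc_dsrc : forall G H F x, subface G H ->
    rsrc G H F (dsrc G F x) = dsrc H F (rsrc G H F x);
  rsrc_pull : forall G H F F' x, subface G H -> subface F F' ->
    rsrc G H F (pull (Some G) F F' x) = pull (Some H) F F' (rsrc G H F' x);

  stokes : forall G F x,
    fint G F (dsrc G F x) =
      \sum_(H : face | facet G H) fint H F (rsrc G H F x) *~ incidence Gamma G H;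

  (* pullback along the evaluation T[1]F x F_F -> Y, in the F_F directions;
     rho_{FG} restricts the evaluation of F to G *)
  ev : forall F, {linear Y -> frm (Some F) F};
  ev_alg : forall F, algebra_map (ev F);
  ev_delta : forall F y, ev F (td Y y) = delta (Some F) F (ev F y);
  ev_restr : forall F G y, subface F G ->
    rsrc F G F (ev F y) = pull (Some G) F G (ev G y);

  (* lifts to F_F of the de Rham vector field of T[1]F, by precomposition, and
     of the vector fields of Y, by postcomposition *)
  lift_src : forall F, vect F;
  lift_src_deg : forall F, vdeg 1 (lift_src F);
  lift_srcE : forall F m y, bideg 0 m y ->
    contr (Some F) (lift_src F) (delta (Some F) F (ev F y)) = dsrc F F (ev F y);
  lift_tgt : forall F, tvect Y -> vect F;
  lift_tgt_deg : forall F q X, tvdeg q X -> vdeg q (lift_tgt F X);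
  lift_tgtE : forall F X m y, bideg 0 m y ->
    contr (Some F) (lift_tgt F X) (delta (Some F) F (ev F y))
      = ev F (tcontr X (td Y y))
}.

Section BF.
Variables (Gamma : closed_oriented_surface R) (Y : bf_target).
Variable C : field_calculus Gamma Y.

Definition superA (F : face) : lie_valued (frm C (Some F) F) :=
  fun i => ev C F (coordA Y i).

Definition superB (F : face) : lie_valued (frm C (Some F) F) :=
  fun i => ev C F (coordB Y i).

Definition alphaBF (F : face) : frm C None F :=
  fint C F F (lpair (superB F) (fun i => delta C (Some F) F (superA F i))).

Definition omegaBF (F : face) : frm C None F :=
  fint C F F (lpair (fun i => delta C (Some F) F (superB F i))
                    (fun i => delta C (Some F) F (superA F i))).

Definition SBF (F : face) : frm C None F :=
  fint C F F (lpair (superB F)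
    (fun i => dsrc C F F (superA F i)
              + 2^-1 *: lbracket (superA F) (superA F) i)).

Definition QBF (QY : tvect Y) (F : face) : vect C F :=
  lift_src C F + lift_tgt C F QY.

Definition rho (F G : face) : frm C None G -> frm C None F := pull C None F G.

End BF.
End Calculus.

Arguments rho {R g Gamma Y} C F G.

(* Main.v *)
(* Contracting an orientation form dt /\ b or ds /\ b with an outward normal
   leaves, on vectors tangent to the facet, a single term of the wedge product,
   whose sign is the incidence number.

   For the bulk identity, the vector field Q has odd degree, so contracting with
   it is an even derivation commuting with the fiber integral.  The target part
   of Q turns <delta B, delta A> into delta of the cubic term, by the Hamiltonian
   equation pulled back along the evaluation map.  The source part turns it into
   delta <B, dA> + d <B, delta A>, and Stokes' formula converts the exact term
   into the boundary one-forms weighted by incidence numbers.  At a corner, both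
   iterated restrictions agree by functoriality while their coefficients are
   opposite. *)
Require Import Defs.
From mathcomp Require Import all_boot all_order all_algebra.
From mathcomp Require Import all_classical reals topology normedtype derive.

Set Implicit Arguments.
Unset Strict Implicit.
Unset Printing Implicit Defensive.

Import Order.TTheory GRing.Theory Num.Theory.
Local Open Scope ring_scope.

(** * Incidence numbers of the product orientations *)

Section Incidence.
Variables (R : realType) (Gamma : closed_oriented_surface R).
Implicit Types (F G : face) (b : ext_form R) (v : tangent R)
  (vs : seq (tangent R)).

(** Antiderivation rule for contraction with [v]: every later slot of [theta] is shifted by one,
    hence the minus sign. *)
Lemma wedge1_cons (theta : tangent R -> R) b v vs :
  wedge1 theta b (v :: vs)
  = theta v * b vs - wedge1 theta (contract v b) vs.
Proof.
rewrite /wedge1 big_ord_recl /= expr0 mul1r drop0 -sumrN; congr (_ + _).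
by apply: eq_bigr => i _; rewrite exprS mulN1r !mulNr.
Qed.

Lemma eq_wedge1 (theta : tangent R -> R) b b' vs :
  (forall us, {subset us <= vs} -> b us = b' us) ->
  wedge1 theta b vs = wedge1 theta b' vs.
Proof.
move=> eqb; apply: eq_bigr => i _; rewrite eqb // => v.
by rewrite mem_cat => /orP[/mem_take|/mem_drop].
Qed.

Lemma wedge1_eq0 (theta : tangent R -> R) b vs :
  (forall v, v \in vs -> theta v = 0) -> wedge1 theta b vs = 0.
Proof.
move=> th0; apply: big1 => i _.
by rewrite th0 ?mulr0 ?mul0r // mem_nth.
Qed.

Lemma wedge1_cons_tangent (theta : tangent R -> R) b v vs :
  (forall u, u \in vs -> theta u = 0) ->
  wedge1 theta b (v :: vs) = theta v * b vs.
Proof. by move=> th0; rewrite wedge1_cons [X in _ - X]wedge1_eq0 ?subr0. Qed.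

Lemma wedge1Zr (theta : tangent R -> R) (a : R) b vs :
  wedge1 theta (fun us => a * b us) vs = a * wedge1 theta b vs.
Proof. by rewrite mulr_sumr; apply: eq_bigr => i _; rewrite mulrCA. Qed.

Definition end_sign (e : bool) : int := if e then 1 else -1.

Lemma outward_coordE (e : bool) :
  outward_coord R None (Some e) = (end_sign e)%:~R.
Proof. by case: e. Qed.

Lemma induces_M_Sigma_t (e : bool) :
  induces Gamma faceM (Sigma_t e) (end_sign e).
Proof.
move=> x c _ _ _; exists 1 => // vs _ tan_vs.
rewrite mulr1 -outward_coordE /contract /= wedge1_cons_tangent //.
by move=> v /tan_vs[/(_ isT)].
Qed.

Lemma induces_M_Sigma_s (e : bool) :
  induces Gamma faceM (Sigma_s e) (- end_sign e).
Proof.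
move=> x c _ _ _; exists 1 => // vs _ tan_vs.
(* The normal has no [t]-component, so the contraction must pass [dt] to reach [ds]; this costs the
   extra sign. *)
rewrite mulr1 /contract /= wedge1_cons {1}/dt /= mul0r sub0r mulrNz mulNr.
congr (- _); rewrite -wedge1Zr; apply: eq_wedge1 => us sub.
rewrite /contract wedge1_cons_tangent -?outward_coordE //.
by move=> v /sub/tan_vs[_ /(_ isT)].
Qed.

Lemma induces_Sigma_t_corner (e h : bool) :
  induces Gamma (Sigma_t e) (corner e h) (end_sign h).
Proof.
move=> x c _ _ _; exists 1 => // vs _ tan_vs.
rewrite mulr1 -outward_coordE /contract /= wedge1_cons_tangent //.
by move=> v /tan_vs[_ /(_ isT)].
Qed.

Lemma induces_Sigma_s_corner (e h : bool) :
  induces Gamma (Sigma_s h) (corner e h) (end_sign e).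
Proof.
move=> x c _ _ _; exists 1 => // vs _ tan_vs.
rewrite mulr1 -outward_coordE /contract /= wedge1_cons_tangent //.
by move=> v /tan_vs[/(_ isT)].
Qed.

(** Nonvanishing on some tangent frame is what prevents a facet from being induced with both
    signs. *)
Lemma or_face_neq0 F :
  exists (x : Gamma * (R * R)) (c : chart R Gamma) vs,
    [/\ face_points F x, surf_atlas c & chart_dom c x.1] /\
    [/\ size vs = fdim F, forall v, v \in vs -> tangent_to F v
      & or_face F c x.1 vs != 0 :> R].
Proof.
have [p _] := surf_nonempty Gamma.
have [c atl_c dom_p] := surf_cover p.
pose tau (o : option bool) : R := if o is Some e then e%:R else 0.
have tauP o : coord_in o (tau o) by case: o => //=; rewrite lexx ler01.
pose e (i : 'I_2) : tangent R := (0, 0, delta_mx ord0 i).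
pose es := [:: e ord0; e ord_max].
pose ut : tangent R := (1, 0, 0); pose us : tangent R := (0, 1, 0).
(* Free coordinates are set to 0; the frame lists the unit vectors of the free interval directions,
   then the chart basis of [Gamma]. *)
exists (p, (tau F.1, tau F.2)), c,
  (nseq (F.1 == None) ut ++ nseq (F.2 == None) us ++ es).
split; first by split => //; split; apply: tauP.
split; first by rewrite !size_cat !size_nseq /fdim /= addnA addnC addnA.
  move=> v; rewrite !mem_cat !mem_nseq !inE.
  by case: F => [[?|] [?|]] /=; do ?[case/orP]; move/eqP => ->; split.
have or_es : or_Gamma c p es != 0.
  rewrite /or_Gamma (_ : \matrix_(_, _) _ = 1%:M); last first.
    apply/matrixP => i j; rewrite !mxE.
    case: i => -[|[|//]] i2 /=; rewrite mxE /= eq_sym;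
    by congr (_%:R); congr nat_of_bool; apply/eqP/eqP => ->; apply/val_inj.
  rewrite det1 mulr1; apply: surf_or_neq0 => //.
  exact: chart_fwd_in.
case: F => [[?|] [?|]] //=; do ?[rewrite wedge1_cons_tangent ?mul1r //];
by move=> v; rewrite !inE; do ?[case/orP]; move/eqP => ->.
Qed.

(** Since [incidence] tests the sign 1 first, the case -1 must exclude it: both signs together would
    make [l + l'], a sum of positive factors, annihilate a nonzero value of the orientation form. *)
Lemma incidenceP F G (e : bool) :
  induces Gamma F G (end_sign e) -> incidence Gamma F G = end_sign e.
Proof.
rewrite /incidence; case: e => /= ind; first by rewrite asboolT.
rewrite [X in if X then _ else _]asboolF ?asboolT // => ind1.
have [x [c [vs [[xG atl_c dom_x] [sz tan /negP[]]]]]] := or_face_neq0 G.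
have [l l0 /(_ vs sz tan) eqF] := ind x c xG atl_c dom_x.
have [l' l'0 /(_ vs sz tan) /eqP] := ind1 x c xG atl_c dom_x.
rewrite eqF mulN1r mul1r mulNr eq_sym -subr_eq0 opprK -mulrDl mulf_eq0.
by rewrite gt_eqF ?addr_gt0.
Qed.

Lemma incidence_M_Sigma_t (e : bool) :
  incidence Gamma faceM (Sigma_t e) = end_sign e.
Proof. exact/incidenceP/induces_M_Sigma_t. Qed.

Lemma incidence_M_Sigma_s (e : bool) :
  incidence Gamma faceM (Sigma_s e) = - end_sign e.
Proof.
have -> : - end_sign e = end_sign (~~ e) by case: e.
by apply: incidenceP; have := @induces_M_Sigma_s e; case: e.
Qed.

Lemma incidence_Sigma_t_corner (e h : bool) :
  incidence Gamma (Sigma_t e) (corner e h) = end_sign h.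
Proof. exact/incidenceP/induces_Sigma_t_corner. Qed.

Lemma incidence_Sigma_s_corner (e h : bool) :
  incidence Gamma (Sigma_s h) (corner e h) = end_sign e.
Proof. exact/incidenceP/induces_Sigma_s_corner. Qed.

(** Both products consist of the end signs of [e] and [h]; only the path through [Sigma_s] carries
    the sign from passing [dt]. *)
Lemma incidence2_opp (e h : bool) :
  incidence2 Gamma faceM (Sigma_t e) (corner e h)
  = - incidence2 Gamma faceM (Sigma_s h) (corner e h).
Proof.
rewrite /incidence2 incidence_M_Sigma_t incidence_M_Sigma_s.
by rewrite incidence_Sigma_t_corner incidence_Sigma_s_corner mulNr opprK mulrC.
Qed.

End Incidence.

(** * Pairing and bracket of Lie-algebra-valued elements *)

Section LieValued.
Variables (R : realType) (g : quadratic_lie_algebra R).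
Implicit Types D E : bigraded_algebra R.

Lemma eq_lpair D (x x' y y' : lie_valued g D) :
  x =1 x' -> y =1 y' -> lpair x y = lpair x' y'.
Proof.
by move=> ex ey; apply: eq_bigr => i _; apply: eq_bigr => j _; rewrite ex ey.
Qed.

Lemma lpairDl D (x x' y : lie_valued g D) :
  lpair (fun i => x i + x' i) y = lpair x y + lpair x' y.
Proof.
rewrite -big_split; apply: eq_bigr => i _; rewrite -big_split /=.
by apply: eq_bigr => j _; rewrite mulrDl scalerDr.
Qed.

Lemma lpairDr D (x y y' : lie_valued g D) :
  lpair x (fun i => y i + y' i) = lpair x y + lpair x y'.
Proof.
rewrite -big_split; apply: eq_bigr => i _; rewrite -big_split /=.
by apply: eq_bigr => j _; rewrite mulrDr scalerDr.
Qed.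

Lemma lpairZr D (a : R) (x y : lie_valued g D) :
  lpair x (fun i => a *: y i) = a *: lpair x y.
Proof.
rewrite scaler_sumr; apply: eq_bigr => i _; rewrite scaler_sumr.
by apply: eq_bigr => j _; rewrite -scalerAr !scalerA mulrC.
Qed.

Lemma lpair_map D E (f : {linear D -> E}) (x y : lie_valued g D) :
  algebra_map f -> f (lpair x y) = lpair (fun i => f (x i)) (fun i => f (y i)).
Proof.
case=> _ _ fM; rewrite linear_sum; apply: eq_bigr => i _; rewrite linear_sum.
by apply: eq_bigr => j _; rewrite linearZ /= fM.
Qed.

Lemma lbracket_map D E (f : {linear D -> E}) (x y : lie_valued g D) k :
  algebra_map f ->
  f (lbracket x y k) = lbracket (fun i => f (x i)) (fun i => f (y i)) k.
Proof.
case=> _ _ fM; rewrite linear_sum; apply: eq_bigr => i _; rewrite linear_sum.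
by apply: eq_bigr => j _; rewrite linearZ /= fM.
Qed.

Lemma lpair_der D (k m a b : int) (f : {linear D -> D})
    (x y : lie_valued g D) :
  graded_derivation k m f -> (forall i, bideg a b (x i)) ->
  f (lpair x y) = lpair (fun i => f (x i)) y
                  + (-1) ^ ((k + m) * (a + b)) *: lpair x (fun i => f (y i)).
Proof.
case=> _ fM degx; rewrite linear_sum scaler_sumr -big_split.
apply: eq_bigr => i _; rewrite linear_sum scaler_sumr -big_split.
apply: eq_bigr => j _; rewrite linearZ /= (fM _ _ _ _ (degx i)).
by rewrite scalerDr !scalerA mulrC.
Qed.

End LieValued.

(** * Contraction of the BF two-form with the BF vector field *)

Section BulkIdentity.
Variables (R : realType) (Gamma : closed_oriented_surface R).
Variables (g : quadratic_lie_algebra R) (Y : bf_target g).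
Variable C : field_calculus Gamma Y.
Implicit Types F G : face.

Lemma superA_deg F i : bideg 0 1 (superA C F i).
Proof. by case: (ev_alg C F) => /(_ _ _ _ (coordA_deg Y i)). Qed.

Lemma superB_deg F i : bideg 0 2 (superB C F i).
Proof. by case: (ev_alg C F) => /(_ _ _ _ (coordB_deg Y i)). Qed.

Lemma delta_superB_deg F i : bideg 1 2 (delta C (Some F) F (superB C F i)).
Proof. by have [[/(_ _ _ _ (superB_deg F i))]] := delta_diff C (Some F) F. Qed.

Variable QY : tvect Y.
Hypothesis QY_Q : is_target_Q QY.

Lemma QBF_deg F : vdeg 1 (QBF C QY F).
Proof.
rewrite /QBF -[lift_src C F]scale1r; apply: vdegD; first exact: lift_src_deg.
by apply: lift_tgt_deg; case: QY_Q.
Qed.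

Lemma contr_QBF F y (m : int) : bideg 0 m y ->
  contr (Some F) (QBF C QY F) (delta C (Some F) F (ev C F y))
  = dsrc C F F (ev C F y) + ev C F (tcontr QY (td Y y)).
Proof.
move=> degy; rewrite /QBF -[lift_src C F]scale1r contr_lin scale1r.
by rewrite (lift_srcE C F degy) (lift_tgtE C F QY degy).
Qed.

(** Contraction with the degree-one [QY] has total degree 0, so the Leibniz rule yields no sign. *)
Lemma target_hamilton_lpair :
  lpair (fun i => tcontr QY (td Y (coordB Y i))) (fun i => td Y (coordA Y i))
  + lpair (fun i => td Y (coordB Y i)) (fun i => tcontr QY (td Y (coordA Y i)))
  = td Y (target_hamiltonian Y).
Proof.
case: QY_Q => degQ <-; rewrite (lpair_der _ (tcontr_der degQ) (a:=1) (b:=2)).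
  by rewrite expr0z scale1r.
by move=> i; have [[/(_ _ _ _ (coordB_deg Y i))]] := td_diff Y.
Qed.

(** Evaluation is an algebra map intertwining [td] and [delta], so it carries the target Hamiltonian
    equation to field space. *)
Lemma ev_target_hamilton F :
  lpair (fun i => ev C F (tcontr QY (td Y (coordB Y i))))
        (fun i => delta C (Some F) F (superA C F i))
  + lpair (fun i => delta C (Some F) F (superB C F i))
        (fun i => ev C F (tcontr QY (td Y (coordA Y i))))
  = delta C (Some F) F
      (2^-1 *: lpair (superB C F) (lbracket (superA C F) (superA C F))).
Proof.
have evF := ev_alg C F.
have := congr1 (ev C F) target_hamilton_lpair.
rewrite linearD /= !(lpair_map _ _ evF) ev_delta /target_hamiltonian linearZ /=.
rewrite (lpair_map _ _ evF) => eqQ.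
etransitivity; last etransitivity; [|exact: eqQ|].
  by congr (_ + _); apply: eq_lpair => i //; rewrite ev_delta.
congr (delta C _ _ (_ *: _)); apply: eq_lpair => i //.
exact: lbracket_map.
Qed.

(* The terms in <B, d (delta A)> cancel because [delta] and [dsrc] anticommute. *)
Lemma dsrc_transgression F :
  lpair (fun i => dsrc C F F (superB C F i))
        (fun i => delta C (Some F) F (superA C F i))
  + lpair (fun i => delta C (Some F) F (superB C F i))
        (fun i => dsrc C F F (superA C F i))
  = delta C (Some F) F
      (lpair (superB C F) (fun i => dsrc C F F (superA C F i)))
    + dsrc C F F
      (lpair (superB C F) (fun i => delta C (Some F) F (superA C F i))).
Proof.
have [derd _] := dsrc_diff C F F; have [derD _] := delta_diff C (Some F) F.
rewrite (lpair_der _ derd (superB_deg F)) (lpair_der _ derD (superB_deg F)).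
(* Both differentials have total degree 1 and [superB] has total degree 2, so each Koszul exponent
   is 2. *)
have sgn2 (n : int) : n = 2 -> (-1) ^ n = 1 :> R.
  by move=> ->; rewrite -[LHS]/((-1) ^+ 2) sqrrN expr1n.
rewrite !sgn2 // !scale1r.
rewrite [X in _ = _ + (_ + X)](@eq_lpair _ _ _ _ (superB C F) _ (fun i =>
  (-1) *: delta C (Some F) F (dsrc C F F (superA C F i)))) //; last first.
  by move=> i; rewrite dsrc_delta.
by rewrite lpairZr scaleN1r addrACA subrr addr0 addrC.
Qed.

(** Identifies the boundary terms of Stokes' formula: restricting the superfields of [F] to [G]
    agrees with pulling back those of [G] along the restriction map. *)
Lemma fint_rsrc_alpha F G : subface F G ->
  fint C G F (rsrc C F G F
    (lpair (superB C F) (fun i => delta C (Some F) F (superA C F i))))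
  = rho C F G (alphaBF C G).
Proof.
move=> FG; rewrite /rho /alphaBF pull_fint //; congr (fint C G F _).
rewrite (lpair_map _ _ (rsrc_alg C F FG)) (lpair_map _ _ (pull_alg C _ FG)).
apply: eq_lpair => i; first exact: ev_restr.
by rewrite rsrc_delta // pull_delta // /superA ev_restr.
Qed.

(** Holds on every face; the sign in front comes from moving [delta] through the fiber integral in
    [SBF]. *)
Lemma contr_QBF_omegaBF F :
  contr None (QBF C QY F) (omegaBF C F)
  = (-1) ^+ fdim F *: delta C None F (SBF C F)
    + \sum_(G | facet F G)
        rho C F G (alphaBF C G) *~ incidence Gamma F G.
Proof.
have degQ := QBF_deg F.
rewrite /omegaBF (fint_contr _ degQ) subrr mul0r expr0z scale1r.
rewrite /SBF fint_delta scalerA -signr_odd -expr2 sqrr_sign scale1r.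
rewrite lpairDr lpairZr.
transitivity (fint C F F
  (delta C (Some F) F (lpair (superB C F) (fun i => dsrc C F F (superA C F i))
     + 2^-1 *: lpair (superB C F) (lbracket (superA C F) (superA C F)))
   + dsrc C F F
      (lpair (superB C F) (fun i => delta C (Some F) F (superA C F i))))).
  congr (fint C F F _).
  rewrite (lpair_der _ (contr_der (Some F) degQ) (delta_superB_deg F)).
  rewrite expr0z scale1r linearD /= addrAC.
  (* Source and target terms are regrouped by the factor on which the contraction acts, matching the
     two summands of [contr_QBF]. *)
  rewrite -dsrc_transgression -ev_target_hamilton addrACA -lpairDl -lpairDr.
  by congr (_ + _); apply: eq_lpair => i //;
    [exact: contr_QBF (coordB_deg Y i) | exact: contr_QBF (coordA_deg Y i)].
rewrite linearD /=; congr (_ + _).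
rewrite stokes; apply: eq_bigr => G /andP[FG _].
by rewrite fint_rsrc_alpha.
Qed.

End BulkIdentity.

(** * The four facets of the bulk and its corners *)

Lemma big_facet_M (V : nmodType) (f : face -> V) :
  \sum_(G | facet faceM G) f G
  = f (Sigma_t true) + f (Sigma_t false) + f (Sigma_s true) + f (Sigma_s false).
Proof.
rewrite (eq_bigl (mem [:: Sigma_t true; Sigma_t false;
                          Sigma_s true; Sigma_s false])); last first.
  by case=> [[[]|] [[]|]].
by rewrite -big_uniq //= !big_cons big_nil addr0 !addrA.
Qed.

Theorem proposition7p2 (R : realType) (Gamma : closed_oriented_surface R)
    (g : quadratic_lie_algebra R) (Y : bf_target g) (C : field_calculus Gamma Y)
    (QY : tvect Y) (hQY : is_target_Q QY) :
  (* the two coefficients at each corner are opposite *)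
  (forall e h : bool,
     incidence2 Gamma faceM (Sigma_t e) (corner e h)
     = - incidence2 Gamma faceM (Sigma_s h) (corner e h))
  (* the table: [M : Sigma] = a, [Sigma : corner] = b, product = c *)
  /\ [/\ (* Gamma_00 *)
         incidence_cell Gamma (Sigma_t false) (corner false false) (-1) (-1) 1
         /\ incidence_cell Gamma (Sigma_s false) (corner false false) 1 (-1) (-1),
         (* Gamma_01 *)
         incidence_cell Gamma (Sigma_t false) (corner false true) (-1) 1 (-1)
         /\ incidence_cell Gamma (Sigma_s true) (corner false true) (-1) (-1) 1,
         (* Gamma_10 *)
         incidence_cell Gamma (Sigma_t true) (corner true false) 1 (-1) (-1)
         /\ incidence_cell Gamma (Sigma_s false) (corner true false) 1 1 1
       & (* Gamma_11 *)
         incidence_cell Gamma (Sigma_t true) (corner true true) 1 1 1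
         /\ incidence_cell Gamma (Sigma_s true) (corner true true) (-1) 1 (-1)]
  (* the bulk BF identity *)
  /\ contr None (QBF C QY faceM) (omegaBF C faceM)
     = delta C None faceM (SBF C faceM)
       + rho C faceM (Sigma_t true) (alphaBF C (Sigma_t true))
       - rho C faceM (Sigma_t false) (alphaBF C (Sigma_t false))
       - rho C faceM (Sigma_s true) (alphaBF C (Sigma_s true))
       + rho C faceM (Sigma_s false) (alphaBF C (Sigma_s false))
  (* the codimension-two contribution vanishes at every corner *)
  /\ (forall e h : bool,
       \sum_(S <- [:: Sigma_t e; Sigma_s h])
          (rho C faceM S \o rho C S (corner e h)) (alphaBF C (corner e h))
            *~ incidence2 Gamma faceM S (corner e h) = 0).
Proof.
split; first exact: incidence2_opp.
split.
  split; split; split; rewrite /incidence2 ?incidence_M_Sigma_t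
    ?incidence_M_Sigma_s ?incidence_Sigma_t_corner ?incidence_Sigma_s_corner //.
split.
  rewrite contr_QBF_omegaBF // big_facet_M !incidence_M_Sigma_t.
  (* The bulk has dimension 4, so the dimension sign is trivial. *)
  rewrite !incidence_M_Sigma_s -signr_odd expr0 scale1r !addrA.
  by rewrite /= opprK mulr1z mulrN1z mulr1z mulrN1z.
move=> e h; rewrite !big_cons big_nil addr0 incidence2_opp mulrNz.
by rewrite /= /rho !pull_comp ?addNr //= /subface /= eqxx.
Qed.
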